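(* Let $\mathcal{C}$ be the set of all finite compositions $\mu = (\mu_1, \ldots, \mu_k)$ (including the empty composition $()$) with each $\mu_i \in \{1, 2\}$ and such that the last part is not $2$; write $|\mu| = \mu_1 + \cdots + \mu_k$. Define maps $\mu \mapsto \lambda_d(\mu)$ and $\mu \mapsto \lambda_o(\mu)$ from $\mathcal{C}$ to partitions recursively as follows. If $\mu = ()$, then $\lambda_d(\mu) = \lambda_o(\mu)$ is the empty partition; if $\mu = (1)$, then $\lambda_d(\mu) = \lambda_o(\mu) = (1)$. Otherwise write $\mu = (\mu_1, \mu')$ with $\mu_1 \in \{1,2\}$ and $\mu' \in \mathcal{C}$ nonempty. - For $\lambda_d$: let $\lambda_d(\mu') = (\lambda_1, \lambda_2, \lambda_3, \ldots)$. If $\mu_1 = 1$, set $\lambda_d(\mu) = (\lambda_1 + 1, \lambda_2, \lambda_3, \ldots)$; if $\mu_1 = 2$, set $\lambda_d(\mu) = (\lambda_1 + 1, \lambda_1, \lambda_2, \lambda_3, \ldots)$. - For $\lambda_o$: let $\lambda_o(\mu') = (\lambda_1, \lambda_2, \lambda_3, \ldots)$. If $\mu_1 = 1$, set $\lambda_o(\mu) = (\lambda_1, \lambda_1, \lambda_2, \lambda_3, \ldots)$; if $\mu_1 = 2$, set $\lambda_o(\mu) = (\lambda_1 + 2, \lambda_2, \lambda_3, \ldots)$. Then $\mu \mapsto \lambda_d(\mu)$ is a bijection from $\mathcal{C}$ onto the set of partitions into distinct parts, $\mu \mapsto \lambda_o(\mu)$ is a bijection from $\mathcal{C}$ onto the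 set of partitions into odd parts, and for every $\mu \in \mathcal{C}$ both $\lambda_d(\mu)$ and $\lambda_o(\mu)$ have perimeter $|\mu|$.
   Context: A partition $\lambda = (\lambda_1, \ldots, \lambda_\ell)$ is a finite weakly decreasing sequence of positive integers (the empty partition is allowed). It is a partition into distinct parts if $\lambda_1 > \cdots > \lambda_\ell$, and into odd parts if every $\lambda_i$ is odd. The perimeter of a nonempty partition is $\lambda_1 + \ell - 1$; the empty partition has perimeter $0$. *)

(* Defs.v *)
From mathcomp Require Import all_boot.
From mathcomp Require Import classical_sets functions.

Set Implicit Arguments.
Unset Strict Implicit.
Unset Printing Implicit Defensive.

Local Open Scope classical_set_scope.

Definition is_partition (la : seq nat) : bool :=
  all (fun i => 0 < i) la && sorted geq la.

Definition distinct_partitions : set (seq nat) :=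
  [set la | is_partition la && sorted gtn la].

Definition odd_partitions : set (seq nat) :=
  [set la | is_partition la && all odd la].

Definition perimeter (la : seq nat) : nat :=
  if la is la1 :: _ then la1 + size la - 1 else 0.

(* The default value 0 of [last] makes the empty composition a member. *)
Definition compositions12 : set (seq nat) :=
  [set mu | all (fun i => (i == 1) || (i == 2)) mu && (last 0 mu != 2)].

(* On [compositions12] a one-part composition is [:: 1], and the image of a
   nonempty composition is nonempty; the values of [lambda_d] and [lambda_o]
   on other sequences, and the [_, _ => [::]] branches, are junk. *)
Fixpoint lambda_d (mu : seq nat) : seq nat :=
  match mu with
  | [::] => [::]
  | [:: _] => [:: 1]
  | mu1 :: mu' =>
      match mu1, lambda_d mu' with
      | 1, la1 :: la => la1 + 1 :: la
      | 2, la1 :: la => [:: la1 + 1, la1 & la]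
      | _, _ => [::]
      end
  end.

Fixpoint lambda_o (mu : seq nat) : seq nat :=
  match mu with
  | [::] => [::]
  | [:: _] => [:: 1]
  | mu1 :: mu' =>
      match mu1, lambda_o mu' with
      | 1, la1 :: la => [:: la1, la1 & la]
      | 2, la1 :: la => la1 + 2 :: la
      | _, _ => [::]
      end
  end.

(* Main.v *)
Require Import Defs.
From mathcomp Require Import all_boot.
From mathcomp Require Import classical_sets functions.
From mathcomp Require Import zify.

(** Both maps prepend a part [x] to a composition by applying a step [s x] to
    the image partition.  On the nonempty partitions of the target class, the
    steps are jointly injective, raise the perimeter by [x], and reach every
    partition except [:: 1].  Hence a partition can be undone one step at a
    time down to [:: 1], by strong induction on the perimeter. *)

Definition part12 (x : nat) : bool := (x == 1) || (x == 2).

Lemma compositions12_cons (x : nat) (mu : seq nat) :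
  mu <> [::] ->
  compositions12 (x :: mu) <-> part12 x /\ compositions12 mu.
Proof.
case: mu => // y mu _; rewrite /compositions12 /part12 /=.
by split=> [/andP[/andP[-> ->] ->] | [-> /andP[-> ->]]].
Qed.

(** Since [[:: 2]] is excluded, [[:: 1]] is the only one-part composition, so every longer one is
    reached from it by prepending parts to nonempty tails. *)
Lemma compositions12_ind (Q : seq nat -> Prop) :
  Q [::] -> Q [:: 1] ->
  (forall x mu, part12 x -> compositions12 mu -> mu <> [::] -> Q mu ->
    Q (x :: mu)) ->
  forall mu, compositions12 mu -> Q mu.
Proof.
move=> Q0 Q1 QS; elim=> // x [_|y mu IH].
  by rewrite /compositions12 /= => /andP[/andP[/orP[/eqP->|/eqP->]]].
move=> /compositions12_cons[] // px Cmu.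
by apply: QS => //; apply: IH.
Qed.

Lemma step_map_bij (P : pred (seq nat)) (f : seq nat -> seq nat)
    (s : nat -> seq nat -> seq nat) :
  f [::] = [::] -> f [:: 1] = [:: 1] ->
  (forall x mu, mu <> [::] -> f (x :: mu) = s x (f mu)) ->
  P [::] -> P [:: 1] ->
  (forall x la, part12 x -> P la -> la <> [::] ->
    [/\ P (s x la), s x la <> [::], s x la <> [:: 1]
      & perimeter (s x la) = x + perimeter la]) ->
  (forall x y la la', part12 x -> part12 y -> P la -> P la' ->
    la <> [::] -> la' <> [::] -> s x la = s y la' -> x = y /\ la = la') ->
  (forall la, P la -> la <> [::] -> la <> [:: 1] ->
    exists x la', [/\ part12 x, P la', la' <> [::] & la = s x la']) ->
  set_bij compositions12 [set la | P la]%classic f /\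
  (forall mu, compositions12 mu -> perimeter (f mu) = sumn mu).
Proof.
move=> f0 f1 fS P0 P1 stepP step_inj step_surj.
have Pf mu : compositions12 mu -> P (f mu).
  (* Nonemptiness is carried along because the steps are controlled on nonempty partitions only. *)
  have : compositions12 mu -> P (f mu) /\ (mu <> [::] -> f mu <> [::]).
    move: mu; apply: compositions12_ind; rewrite ?f0 ?f1 //.
    move=> x mu px _ mu0 [Pm /(_ mu0) fm0]; rewrite fS //.
    by have [] := stepP x _ px Pm fm0.
  by move=> H /H[].
have f_neq0 mu : compositions12 mu -> mu <> [::] -> f mu <> [::].
  move: mu; apply: compositions12_ind; rewrite ?f1 //.
  move=> x mu px Cmu mu0 /(_ mu0) fm0 _; rewrite fS //.
  by have [] := stepP x _ px (Pf _ Cmu) fm0.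
have fS_neq1 x mu : part12 x -> compositions12 mu -> mu <> [::] ->
    f (x :: mu) <> [:: 1].
  move=> px Cmu mu0; rewrite fS //.
  by have [] := stepP x _ px (Pf _ Cmu) (f_neq0 _ Cmu mu0).
have cons_C x mu : part12 x -> compositions12 mu -> mu <> [::] ->
    compositions12 (x :: mu).
  by move=> px Cmu mu0; apply/compositions12_cons.
split; last first.
  apply: compositions12_ind; rewrite ?f0 ?f1 //= => x mu px Cmu mu0 IH.
  by rewrite fS // -IH; have [] := stepP x _ px (Pf _ Cmu) (f_neq0 _ Cmu mu0).
split.
- by move=> mu /Pf.
(* Injectivity: induction on [mu], then the same principle serves as a case analysis on [nu]. A step
   output is never [[::]] or [[:: 1]], which settles the mixed cases. *)
- move=> mu nu; rewrite !inE => Cmu Cnu; move: mu Cmu nu Cnu.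
  apply: compositions12_ind.
  + move=> nu; case: (nu =P [::]) => [-> //|nu0 Cnu].
    by rewrite f0 => /esym /(f_neq0 _ Cnu nu0).
  + move=> nu Cnu; rewrite f1.
    move: nu Cnu; apply: compositions12_ind; rewrite ?f0 //.
    by move=> x nu px Cnu nu0 _ /esym /(fS_neq1 _ _ px Cnu nu0).
  + move=> x mu px Cmu mu0 IH nu Cnu.
    move: nu Cnu; apply: compositions12_ind.
    * by rewrite f0 => f_eq0; case: (f_neq0 _ (cons_C _ _ px Cmu mu0)).
    * by rewrite f1 => /(fS_neq1 _ _ px Cmu mu0).
    * move=> y nu py Cnu nu0 _; rewrite !fS // => e.
      have [-> /(IH _ Cnu) ->//] := step_inj _ _ _ _ px py (Pf _ Cmu)
        (Pf _ Cnu) (f_neq0 _ Cmu mu0) (f_neq0 _ Cnu nu0) e.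
- move=> la /= Pla.
  (* Undoing a step lowers the perimeter by a part, hence by at least 1. *)
  have [n] := ubnP (perimeter la); elim: n la Pla => // n IH la Pla lan.
  case: (la =P [::]) => [->|la0]; first by exists [::].
  case: (la =P [:: 1]) => [->|la1]; first by exists [:: 1].
  have [x [la' [px Pla' la'0 la_def]]] := step_surj la Pla la0 la1.
  have [|mu Cmu fmu] := IH la' Pla'.
    by have [_ _ _] := stepP x la' px Pla' la'0; rewrite -la_def;
       move: px lan; rewrite /part12; lia.
  have mu0 : mu <> [::] by move=> mu0; apply: la'0; rewrite -fmu mu0.
  by exists (x :: mu); rewrite ?fS ?fmu //; apply: cons_C.
Qed.

Definition step_d (x : nat) (la : seq nat) : seq nat :=
  match x, la with
  | 1, la1 :: la => la1 + 1 :: la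
  | 2, la1 :: la => [:: la1 + 1, la1 & la]
  | _, _ => [::]
  end.

Definition step_o (x : nat) (la : seq nat) : seq nat :=
  match x, la with
  | 1, la1 :: la => [:: la1, la1 & la]
  | 2, la1 :: la => la1 + 2 :: la
  | _, _ => [::]
  end.

Definition distinctp (la : seq nat) : bool := is_partition la && sorted gtn la.
Definition oddp (la : seq nat) : bool := is_partition la && all odd la.

(** By transitivity, comparing [a] with the next part suffices; the default 0 of [head] makes the
    comparison harmless when [la] is empty. *)
Lemma distinctp_cons (a : nat) (la : seq nat) :
  distinctp (a :: la) = [&& 0 < a, head 0 la < a & distinctp la].
Proof.
rewrite /distinctp /is_partition; case: la => [|b la] /=; first by rewrite !andbT; lia.
by case: (all _ la); case: (path geq b la); case: (path gtn b la); rewrite /=; lia.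
Qed.

Lemma oddp_cons (a : nat) (la : seq nat) :
  oddp (a :: la) = [&& odd a, head 0 la <= a & oddp la].
Proof.
rewrite /oddp /is_partition; case: la => [|b la] /=; first by rewrite !andbT; lia.
by case: (all _ la); case: (path geq b la); case: (all odd la); rewrite /=; lia.
Qed.

Lemma distinctp_head0 (la : seq nat) : distinctp la -> head 0 la = 0 -> la = [::].
Proof. by case: la => // a la; rewrite distinctp_cons /=; lia. Qed.

Lemma oddp_head0 (la : seq nat) : oddp la -> head 0 la = 0 -> la = [::].
Proof. by case: la => // a la; rewrite oddp_cons /= => /andP[+ _]; lia. Qed.

Lemma lambda_d_bij :
  set_bij compositions12 distinct_partitions lambda_d /\
  (forall mu, compositions12 mu -> perimeter (lambda_d mu) = sumn mu).
Proof.
apply: (@step_map_bij distinctp _ step_d) => //.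
- by move=> x [].
- move=> x [//|a la] /orP[] /eqP-> + _; rewrite distinctp_cons => /and3P[a0 ha dla] /=.
    by rewrite !distinctp_cons dla /=; split=> [|//|[]|]; lia.
  by rewrite !distinctp_cons /= dla; split=> [|//|//|]; lia.
- move=> x y [//|a la] [//|b lb] /orP[] /eqP-> /orP[] /eqP->;
    rewrite !distinctp_cons => /and3P[a0 ha dla] /and3P[b0 hb dlb] _ _ /= [].
  + by move=> /addIn-> ->.
  (* The two steps cannot agree: step 1 leaves a gap of at least 2 between the two largest parts,
     step 2 a gap of exactly 1. *)
  + by move=> ab la_def; move: ha; rewrite la_def /=; lia.
  + by move=> ab la_def; move: hb; rewrite -la_def /=; lia.
  + by move=> _ -> ->.
- case=> [//|c la]; rewrite distinctp_cons => /and3P[c0 hc dla] _ c1.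
  have c_gt1 : 1 < c.
    case: (ltnP 1 c) => // c_le1; case: c1; rewrite (distinctp_head0 la dla); last lia.
    by congr [:: _]; lia.
  (* The gap after the largest part decides which step to undo; an empty [la] falls under step 1, as
     [c] exceeds 1. *)
  case: (ltnP (head 0 la) c.-1) => hla.
    exists 1, (c.-1 :: la); split=> //=; last by congr cons; lia.
    by rewrite distinctp_cons dla hla; lia.
  exists 2, la; case: la hc hla dla {c1} => [|b la] /= hc hla dla; first lia.
  by split=> //; congr [:: _, _ & _]; lia.
Qed.

Lemma lambda_o_bij :
  set_bij compositions12 odd_partitions lambda_o /\
  (forall mu, compositions12 mu -> perimeter (lambda_o mu) = sumn mu).
Proof.
apply: (@step_map_bij oddp _ step_o) => //.
- by move=> x [].
- move=> x [//|a la] /orP[] /eqP-> + _; rewrite oddp_cons => /and3P[a0 ha dla] /=.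
    by rewrite !oddp_cons /= dla a0 ha; split=> //; lia.
  by rewrite !oddp_cons dla /=; split=> [|//|[]|]; lia.
- move=> x y [//|a la] [//|b lb] /orP[] /eqP-> /orP[] /eqP->;
    rewrite !oddp_cons => /and3P[a0 ha dla] /and3P[b0 hb dlb] _ _ /= [].
  + by move=> _ -> ->.
  (* Step 1 makes the two largest parts equal, whereas step 2 makes the largest part strictly
     dominant. *)
  + by move=> ab lb_def; move: hb; rewrite -lb_def /=; lia.
  + by move=> ab la_def; move: ha; rewrite la_def /=; lia.
  + by move=> /addIn-> ->.
- case=> [//|c la]; rewrite oddp_cons => /and3P[oc hc dla] _ c1.
  case: (ltnP (head 0 la) c) => hla; last first.
    exists 1, la; case: la hc hla dla {c1} => [|b la] /= hc hla dla; first lia.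
    by split=> //; congr [:: _, _ & _]; lia.
  have c_gt2 : 2 < c.
    case: (ltnP 2 c) => // c_le2; case: c1; rewrite (oddp_head0 la dla); last lia.
    by congr [:: _]; lia.
  exists 2, (c - 2 :: la); split=> //=; last by congr cons; lia.
  (* Two distinct odd numbers differ by at least 2, so [c - 2] still bounds the next part. The
     default head 0 is even, hence the proviso that [la] is nonempty. *)
  have ola : la <> [::] -> odd (head 0 la).
    by case: (la) dla => // b l; rewrite oddp_cons => /andP[].
  rewrite oddp_cons dla /=; case: (la) hla ola => [|b l] /= hla; first lia.
  by move=> /(_ ltac:(by [])); lia.
Qed.

Theorem theorem11 :
  [/\ set_bij compositions12 distinct_partitions lambda_d,
      set_bij compositions12 odd_partitions lambda_o
    & forall mu : seq nat, compositions12 mu ->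
        perimeter (lambda_d mu) = sumn mu /\ perimeter (lambda_o mu) = sumn mu].
Proof.
have [bij_d per_d] := lambda_d_bij; have [bij_o per_o] := lambda_o_bij.
by split=> // mu Cmu; split; [apply: per_d | apply: per_o].
Qed.
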